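(* Let $P$ be a finite poset, $\mathcal{J}\subseteq\mathrm{Hom}(P,\mathbb{N})$ a poset ideal, and $S$ a finite set with $\mathrm{Supp}(\mathcal{J})\subseteq S\subseteq P\times\mathbb{N}$, given the induced partial order from $P\times\mathbb{N}$. Let $R$ be a poset and $\phi:S\to R$ an isotone map with left strict chain fibers. Let $B$ be a basis of the kernel of the $k$-linear map $\bigoplus_{s\in S}k x_s\to\bigoplus_{r\in R}k x_r$, $x_s\mapsto x_{\phi(s)}$, consisting of differences $x_{s}-x_{s'}$ with $\phi(s)=\phi(s')$. Then $B$ is a regular sequence on $k[x_S]/L(P,\mathcal{J})$.
   Context: $\mathbb{N}=\{0,1,2,\dots\}$; $\mathrm{Hom}(P,\mathbb{N})$ is the set of isotone maps $P\to\mathbb{N}$ ordered pointwise; $\mathcal{J}^c$ is the complement of $\mathcal{J}$. The ascent of $\psi$ is $\Lambda\psi=\{(p,i): \psi(q)\le i<\psi(p)\ \forall q<p\}$. A marker for $\mathcal{J}$ is a poset ideal $I\subseteq P$ with an isotone $\alpha:I\to\mathbb{N}$ such that every isotone extension of $\alpha$ to $P$ lies in $\mathcal{J}$; its graph is $\Gamma\alpha=\{(p,\alpha(p)):p\in I\}$. With $k$ a field and $m_T=\prod_{t\in T}x_t$, the co-letterplace ideal $L(P,\mathcal{J})$ is generated by $m_{\Gamma\alpha}$ over markers $\alpha$ of $\mathcal{J}$, and the letterplace ideal $L(\mathcal{J},P)$ by $m_{\Lambda\psi}$, $\psi\in\mathcal{J}^c$. $\mathrm{Supp}(\mathcal{J})$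 is the (finite) set of $(p,i)$ such that $x_{p,i}$ divides some minimal monomial generator of $L(P,\mathcal{J})$ (equivalently of its Alexander dual $L(\mathcal{J},P)$); for $S\supseteq\mathrm{Supp}(\mathcal{J})$ these are regarded as ideals of $k[x_S]$ generated by their minimal generators. $P^{\mathrm{op}}\times\mathbb{N}$ has the product order with $P^{\mathrm{op}}$ the opposite poset. The map $\phi$ has left strict chain fibers if each fiber $\phi^{-1}(r)$ is a chain in $P^{\mathrm{op}}\times\mathbb{N}$ whose elements have pairwise distinct first coordinates. *)

(* Defs.v *)
From HB Require Import structures.
From mathcomp Require Import all_boot all_order all_algebra.
From mathcomp Require Import mpoly.

Set Implicit Arguments.
Unset Strict Implicit.
Unset Printing Implicit Defensive.

Import Order.TTheory GRing.Theory.
Local Open Scope ring_scope.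

Section CoLetterplace.

Variables (d : Order.disp_t) (P : finPOrderType d).

Definition isotone (f : P -> nat) : Prop :=
  forall p q : P, (p <= q)%O -> (f p <= f q)%N.

Definition hom_ideal (J : (P -> nat) -> Prop) : Prop :=
  (forall f, J f -> isotone f) /\
  (forall f g : P -> nat, J g -> isotone f -> (forall p, (f p <= g p)%N) -> J f).

Definition down_closed (I : {set P}) : Prop :=
  forall p q : P, q \in I -> (p <= q)%O -> p \in I.

(** a map alpha : I -> N, represented by a : P -> nat (values off I irrelevant) *)
Definition isotone_on (I : {set P}) (a : P -> nat) : Prop :=
  forall p q : P, p \in I -> q \in I -> (p <= q)%O -> (a p <= a q)%N.

Definition is_marker (J : (P -> nat) -> Prop) (I : {set P}) (a : P -> nat) : Prop :=
  [/\ down_closed I, isotone_on I a &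
      forall psi : P -> nat, isotone psi -> (forall p, p \in I -> psi p = a p) -> J psi].

Definition mgraph (I : {set P}) (a : P -> nat) (t : P * nat) : Prop :=
  t.1 \in I /\ t.2 = a t.1.

Definition subgraph (I : {set P}) (a : P -> nat) (I' : {set P}) (a' : P -> nat) : Prop :=
  forall t, mgraph I a t -> mgraph I' a' t.

(** markers whose monomial m_{Gamma alpha} is a minimal generator of L(P,J):
    for squarefree monomials divisibility is inclusion of supports *)
Definition min_marker (J : (P -> nat) -> Prop) (I : {set P}) (a : P -> nat) : Prop :=
  is_marker J I a /\
  forall I' a', is_marker J I' a' -> subgraph I' a' I a -> subgraph I a I' a'.

(** Supp(J): variables dividing some minimal generator of L(P,J) *)
Definition Supp (J : (P -> nat) -> Prop) (t : P * nat) : Prop :=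
  exists I a, min_marker J I a /\ mgraph I a t.

Definition lePN (t t' : P * nat) : bool := (t.1 <= t'.1)%O && (t.2 <= t'.2)%N.

Variable n : nat.
Variable S : n.-tuple (P * nat).

Definition isotone_S (d' : Order.disp_t) (R : porderType d') (phi : P * nat -> R) : Prop :=
  forall t t', t \in S -> t' \in S -> lePN t t' -> (phi t <= phi t')%O.

(** fibers are chains of P^op x N with pairwise distinct first coordinates *)
Definition left_strict_chain_fibers (d' : Order.disp_t) (R : porderType d')
  (phi : P * nat -> R) : Prop :=
  forall t t', t \in S -> t' \in S -> phi t = phi t' ->
    [/\ ((t'.1 <= t.1)%O && (t.2 <= t'.2)%N) || ((t.1 <= t'.1)%O && (t'.2 <= t.2)%N)
      & t != t' -> t.1 != t'.1].

Variable k : fieldType.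

(** the variable x_t of k[x_S] (S indexed by 'I_n via the tuple S) *)
Definition xvar (t : P * nat) : {mpoly k[n]} :=
  match @insub nat (fun i => (i < n)%N) 'I_n (index t S) with
  | Some i => 'X_i
  | None => 0
  end.

Definition mono (I : {set P}) (a : P -> nat) : {mpoly k[n]} :=
  \prod_(p in I) xvar (p, a p).

Definition L_gens (J : (P -> nat) -> Prop) (f : {mpoly k[n]}) : Prop :=
  exists I a, min_marker J I a /\ f = mono I a.

End CoLetterplace.

Definition in_ideal (A : comNzRingType) (G : A -> Prop) (f : A) : Prop :=
  exists (gs cs : seq A), (forall g, g \in gs -> G g) /\ size cs = size gs /\
    f = \sum_(i < size gs) cs`_i * gs`_i.

Definition regular_seq (A : comNzRingType) (G : A -> Prop) (fs : seq A) : Prop :=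
  forall i, (i < size fs)%N -> forall g : A,
    in_ideal (fun h => G h \/ h \in take i fs) (fs`_i * g) ->
    in_ideal (fun h => G h \/ h \in take i fs) g.

(** kernel of  (+)_{s in S} k x_s -> (+)_{r in R} k x_r,  x_s |-> x_{phi s} *)
Definition in_kernel (k : fieldType) (d : Order.disp_t) (P : finPOrderType d) (n : nat)
  (S : n.-tuple (P * nat)) (d' : Order.disp_t) (R : porderType d') (phi : P * nat -> R)
  (v : 'rV[k]_n) : Prop :=
  forall r : R, \sum_(i < n | phi (tnth S i) == r) v 0 i = 0.

Definition diffvec (k : fieldType) (n : nat) (b : 'I_n * 'I_n) : 'rV[k]_n :=
  delta_mx 0 b.1 - delta_mx 0 b.2.

Definition kernel_basis (k : fieldType) (d : Order.disp_t) (P : finPOrderType d) (n : nat)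
  (S : n.-tuple (P * nat)) (d' : Order.disp_t) (R : porderType d') (phi : P * nat -> R)
  (B : seq ('I_n * 'I_n)) : Prop :=
  free [seq diffvec k b | b <- B] /\
  forall v : 'rV[k]_n, in_kernel S phi v <-> v \in <<[seq diffvec k b | b <- B]>>%VS.

(* Main.v *)
(** Identifying the variables joined by the first [i] differences turns the
    ideal [L(P,J) + (B_1, ..., B_i)] into a monomial ideal, generated by the
    images of the monomials of the minimal markers, and the next difference
    into [x_a - x_b] with [a <> b] lying in the same fiber of [phi].  Such a
    difference is a nonzerodivisor modulo a monomial ideal [M] as soon as
    [x_a m] and [x_b m] in [M] imply [m] in [M] for every monomial [m].

    To check this, let markers [alpha] and [beta] divide [x_a m] and [x_b m].
    If [alpha] has a point [p] over [a] with [alpha p < beta p], let [gamma] be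
    [beta] above [p] and [min(alpha, beta)] elsewhere; argue symmetrically if
    [beta] has a point [q] over [b] with [beta q < alpha q]; otherwise let
    [gamma = min(alpha, beta)].  As [gamma] is bounded by [beta] or by [alpha],
    it is a marker.  Since fibers are chains in [P^op x N], on which isotone
    maps are constant, the points of [gamma] over any variable are among those
    of [alpha] or among those of [beta], and [gamma] divides [m]. *)

Require Import Defs.
From HB Require Import structures.
From mathcomp Require Import all_boot all_order all_algebra.
From mathcomp Require Import mpoly.
From mathcomp Require Import zify.
From Stdlib Require Import Classical.

Set Implicit Arguments.
Unset Strict Implicit.
Unset Printing Implicit Defensive.

Import Order.TTheory GRing.Theory.
Local Open Scope ring_scope.

(** * Ideals generated by a predicate *)

Section Ideals.
Variable A : comNzRingType.
Implicit Types (G H : A -> Prop) (f g : A).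

Lemma in_idealP G f :
  in_ideal G f <->
  exists s : seq (A * A),
    (forall x, x \in s -> G x.2) /\ f = \sum_(x <- s) x.1 * x.2.
Proof.
split=> [[gs [cs [Ggs [sz ->]]]]|[s [Gs ->]]].
  exists (zip cs gs); split=> [x xs|].
    apply: Ggs; have -> : gs = unzip2 (zip cs gs) by rewrite unzip2_zip // sz.
    exact: map_f.
  rewrite (big_nth (0, 0)) size_zip sz minnn big_mkord.
  by apply: eq_bigr => i _; rewrite nth_zip.
exists (unzip2 s), (unzip1 s); split=> [g /mapP[x xs ->]|]; first exact: Gs.
split; first by rewrite !size_map.
rewrite size_map (big_nth (0, 0)) big_mkord; apply: eq_bigr => i _.
by rewrite !(nth_map (0, 0)).
Qed.

Lemma in_ideal0 G : in_ideal G 0.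
Proof. by apply/in_idealP; exists [::]; rewrite big_nil. Qed.

Lemma in_idealD G f g : in_ideal G f -> in_ideal G g -> in_ideal G (f + g).
Proof.
move=> /in_idealP[s [Gs ->]] /in_idealP[t [Gt ->]].
apply/in_idealP; exists (s ++ t); rewrite big_cat; split=> // x.
by rewrite mem_cat => /orP[/Gs|/Gt].
Qed.

Lemma in_idealMl G f g : in_ideal G g -> in_ideal G (f * g).
Proof.
move=> /in_idealP[s [Gs ->]]; apply/in_idealP.
exists [seq (f * x.1, x.2) | x <- s]; split=> [x /mapP[y ys ->]|]; first exact: (Gs y).
by rewrite big_map mulr_sumr; apply: eq_bigr => x _; rewrite mulrA.
Qed.

Lemma in_idealN G f : in_ideal G f -> in_ideal G (- f).
Proof. by rewrite -mulN1r; apply: in_idealMl. Qed.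

Lemma in_idealB G f g : in_ideal G f -> in_ideal G g -> in_ideal G (f - g).
Proof. by move=> If /in_idealN; apply: in_idealD. Qed.

Lemma in_ideal_gen G g : G g -> in_ideal G g.
Proof.
move=> Gg; apply/in_idealP; exists [:: (1, g)]; rewrite big_seq1 mul1r.
by split=> // x; rewrite inE => /eqP->.
Qed.

Lemma in_ideal_ind G (Q : A -> Prop) :
  Q 0 -> (forall f g, Q f -> Q g -> Q (f + g)) ->
  (forall c g, G g -> Q (c * g)) ->
  forall f, in_ideal G f -> Q f.
Proof.
move=> Q0 QD QM f /in_idealP[s [Gs ->]].
rewrite big_seq; apply: big_ind => // x xs; exact/QM/Gs.
Qed.

Lemma in_ideal_sub G H f :
  (forall g, G g -> in_ideal H g) -> in_ideal G f -> in_ideal H f.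
Proof.
move=> GH; apply: in_ideal_ind => [|? ?|c g /GH]; first exact: in_ideal0.
  exact: in_idealD.
exact: in_idealMl.
Qed.

End Ideals.

(** * Monomial ideals and differences of variables as nonzerodivisors *)

Section MonomialIdeals.
Variables (k : fieldType) (n : nat).
Implicit Types (m u : 'X_{1..n}) (f g : {mpoly k[n]}) (D : 'X_{1..n} -> Prop).

(** All monomials of a multiple of ['X_[u]] are divisible by it, and a sum has no monomials beyond
    those of its summands. Conversely, [f] is the sum of its terms. *)
Lemma mem_monomial_ideal (G : 'X_{1..n} -> Prop) f :
  in_ideal (fun h => exists2 u, G u & h = 'X_[u]) f <->
  (forall m, f@_m != 0 -> exists2 u, G u & (u <= m)%MM).
Proof.
split.
  apply: (in_ideal_ind (Q := fun f => forall m, f@_m != 0 -> _)) => [m|h g IHh IHg m|c g [u Gu ->] m].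
  - by rewrite mcoeff0 eqxx.
  - rewrite mcoeffD; have [->|/IHh//] := eqVneq h@_m 0.
    by rewrite add0r => /IHg.
  - rewrite -mcoeff_msupp (perm_mem (msuppMX c u)) => /mapP[v _ ->].
    by exists u => //; rewrite lem_addr.
move=> Gf; rewrite [f]mpolyE big_seq; apply: big_ind => [|h1 h2|m].
- exact: in_ideal0.
- exact: in_idealD.
rewrite mcoeff_msupp => /Gf[u Gu /submK<-].
rewrite mpolyXD scalerAl; apply/in_idealMl/in_ideal_gen; by exists u.
Qed.

Definition mono_upclosed D := forall m u, D m -> D (m + u)%MM.

(* Comparing coefficients at [m + a], either the monomial lies in the ideal or
   [m + a - b] again occurs in [g]; the exponent of [b] decreases. *)
Lemma nzd_walk D (a b : 'I_n) g m :
  mono_upclosed D -> a != b ->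
  (forall u, (('X_a - 'X_b) * g)@_u != 0 -> D u) ->
  g@_m != 0 -> exists l, D (m + U_(a) *+ l)%MM.
Proof.
move=> upD ab Dg; move e: (m b) => e'.
elim: e' m e => [|e' IH] m e gm.
all: have [Da|nDa] := classic (D (m + U_(a))%MM); first by exists 1%N; rewrite mulm1n.
all: have c0 : (('X_a - 'X_b) * g)@_(m + U_(a)) = 0
  by apply/eqP/negP => /negP /Dg.
all: move: c0; rewrite mulrBl mcoeffB [in X in X - _]mulrC addmC mcoeffMX.
all: move/eqP; rewrite subr_eq0 => /eqP gb; move: (gm); rewrite gb.
all: rewrite mulrC -mcoeff_msupp (perm_mem (msuppMX _ _)) => /mapP[v gv Ev].
all: have /(congr1 (fun w : 'X_{1..n} => w b)) := Ev;
  rewrite !mnmDE !mnm1E (negPf ab) eqxx /= e // !add0n add1n.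
case=> /esym vb; have [|l Dl] := IH v vb; first by rewrite -mcoeff_msupp.
exists l.+1; rewrite mulmS addmA (addmC m) Ev.
by rewrite -addmA addmC; apply: upD.
Qed.

(** Upward closure carries [D (u + U_(a))] to [u + U_(b) *+ l + U_(a)], so saturation strips the
    [b]s one by one; the claim [one] then strips the [a]s in the same way. *)
Lemma mono_saturated_power D (a b : 'I_n) m i j :
  mono_upclosed D ->
  (forall u, D (u + U_(a))%MM -> D (u + U_(b))%MM -> D u) ->
  D (m + U_(a) *+ i)%MM -> D (m + U_(b) *+ j)%MM -> D m.
Proof.
move=> upD sat.
have one u l : D (u + U_(a))%MM -> D (u + U_(b) *+ l)%MM -> D u.
  elim: l => [|l IH] Da; first by rewrite mulm0n addm0.
  rewrite mulmSr addmA => Db; apply: IH => //; apply: sat Db.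
  by rewrite -addmA (addmC (U_(b) *+ _)%MM) addmA; apply: upD.
elim: i => [|i IH]; first by rewrite mulm0n addm0.
rewrite mulmSr addmA => Da Db; apply: IH => //; apply: (one _ j) => //.
by rewrite -addmA (addmC (U_(a) *+ _)%MM) addmA; apply: upD.
Qed.

(** The walk reaches [D] from [m] by adding powers of [a] and, since swapping [a] and [b] only
    changes a sign, also by adding powers of [b]. Saturation brings both back to [m]. *)
Lemma monomial_nzd D (a b : 'I_n) g :
  mono_upclosed D -> a != b ->
  (forall u, D (u + U_(a))%MM -> D (u + U_(b))%MM -> D u) ->
  (forall u, (('X_a - 'X_b) * g)@_u != 0 -> D u) ->
  forall m, g@_m != 0 -> D m.
Proof.
move=> upD ab sat Dg m gm.
have [i Di] := nzd_walk upD ab Dg gm.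
have ba : b != a by rewrite eq_sym.
have [|j Dj] := nzd_walk (g := g) (m := m) upD ba _ gm; last exact: mono_saturated_power Di Dj.
by move=> u; rewrite -opprB mulNr mcoeffN oppr_eq0; apply: Dg.
Qed.

End MonomialIdeals.

(** * Markers of a poset ideal of isotone maps *)

Section Markers.
Variables (d : Order.disp_t) (P : finPOrderType d) (J : (P -> nat) -> Prop).

Lemma subgraphP (I : {set P}) a (I' : {set P}) a' :
  subgraph I a I' a' <-> (I \subset I') /\ {in I, a =1 a'}.
Proof.
split=> [sub|[/subsetP sub eqa] [p i] [/= pI ->]]; last first.
  by split=> /=; [exact: sub | exact: eqa].
by split=> [|p pI]; [apply/subsetP => p pI|]; have [] := sub (p, a p) (conj pI erefl).
Qed.

(** Induction on the size of the domain: the graph of a non-minimal marker properly contains that of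
    another marker. So every marker monomial is a multiple of a minimal generator. *)
Lemma min_marker_below (I : {set P}) a :
  is_marker J I a ->
  exists I' a', [/\ min_marker J I' a', I' \subset I & {in I', a' =1 a}].
Proof.
move: {2}#|I|.+1 (ltnSn #|I|) => c; elim: c I a => // c IH I a.
rewrite ltnS => cI mI.
have [minI|nmin] := classic (min_marker J I a); first by exists I, a.
have [I' [a' [mI' sub nsub]]] : exists I' a',
    [/\ is_marker J I' a', subgraph I' a' I a & ~ subgraph I a I' a'].
  apply: NNPP => no; apply: nmin; split=> // I' a' mI' sub.
  by apply: NNPP => nsub; apply: no; exists I', a'.
have [sI' ea'] := (subgraphP I' a' I a).1 sub.
have [|I2 [a2 [m2 s2 e2]]] := IH I' a' _ mI'.
  apply: leq_trans cI; apply: proper_card; rewrite properE sI'.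
  apply/negP => sI; apply: nsub; apply/subgraphP; split=> // p pI.
  by rewrite ea' // (subsetP sI).
exists I2, a2; split=> //; first exact: subset_trans sI'.
by move=> p p2; rewrite e2 // ea' // (subsetP s2).
Qed.

Lemma marker_ext (I : {set P}) a a' :
  {in I, a' =1 a} -> is_marker J I a -> is_marker J I a'.
Proof.
move=> ea [down iso ext]; split=> // [p q pI qI|psi ipsi epsi].
  by rewrite !ea //; apply: iso.
by apply: ext => // p pI; rewrite epsi // ea.
Qed.

(* Markers with values below [N] correspond to isotone maps capped at [N],
   the value [N] meaning "outside the domain". *)
Definition capped N (I : {set P}) (a : P -> nat) (p : P) : nat :=
  if p \in I then a p else N.

Definition capped_dom N (f : P -> nat) : {set P} := [set p | (f p < N)%N].

Lemma capped_isotone N I a :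
  is_marker J I a -> (forall p, (a p < N)%N) -> isotone (capped N I a).
Proof.
case=> down iso _ aN p q pq; rewrite /capped.
case: ifP => pI; case: ifP => qI //; first exact: iso.
  exact: ltnW.
by rewrite (down _ _ qI pq) in pI.
Qed.

Lemma capped_domE N (I : {set P}) a :
  (forall p, (a p < N)%N) -> capped_dom N (capped N I a) = I.
Proof.
by move=> aN; apply/setP => p; rewrite inE /capped; case: ifP; rewrite ?ltnn ?aN.
Qed.

Lemma capped_marker N (I : {set P}) a :
  (forall p, (a p < N)%N) -> is_marker J I a ->
  is_marker J (capped_dom N (capped N I a)) (capped N I a).
Proof.
move=> aN; rewrite capped_domE //; apply: marker_ext => p pI.
by rewrite /capped pI.
Qed.

(** Every isotone extension of [g] is dominated by one of [f], and [J] is closed downwards. *)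
Lemma marker_le N (f g : P -> nat) :
  hom_ideal J -> isotone f -> isotone g -> (forall p, (g p <= f p)%N) ->
  is_marker J (capped_dom N f) f -> is_marker J (capped_dom N g) g.
Proof.
move=> [_ Jdown] isof isog gf [_ _ mf]; split.
- by move=> p q; rewrite !inE => qN pq; apply: leq_ltn_trans qN; apply: isog.
- by move=> p q _ _; apply: isog.
move=> psi isop Epsi.
(* Off the domain of [f] the values are at least [N], hence above those on it, so [psi'] is isotone.
   On the domain [psi p = g p <= f p], so [psi'] dominates [psi]. *)
pose psi' p := if (f p < N)%N then f p else maxn (psi p) N.
apply: (Jdown psi psi') => [||p] //; last first.
  rewrite /psi'; case: ifP => [fN|_]; last exact: leq_maxl.
  by rewrite Epsi // inE (leq_ltn_trans (gf p)).
apply: mf => [p q pq|p]; rewrite /psi'; last by rewrite inE => ->.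
have fpq := isof _ _ pq; have ppq := isop _ _ pq.
by case: ifP => ?; case: ifP => ?; lia.
Qed.

End Markers.

(** * Exchanging two capped isotone maps fiber by fiber *)

Section Exchange.
Variables (d : Order.disp_t) (P : finPOrderType d).
Variables (T : finType) (kap : P * nat -> option T) (N : nat).
Implicit Types (f g al be : P -> nat) (c : T) (p q : P).

Definition op_comparable (t t' : P * nat) : bool :=
  ((t'.1 <= t.1)%O && (t.2 <= t'.2)%N) || ((t.1 <= t'.1)%O && (t'.2 <= t.2)%N).

Definition left_strict_comparable (t t' : P * nat) : Prop :=
  op_comparable t t' /\ (t != t' -> t.1 != t'.1).

(** The cardinality is the exponent of the variable [c] in the contracted monomial; points at height
    [N] or more lie outside the marker. *)
Definition fiber_pts f c : {set P} :=
  [set p | (f p < N)%N && (kap (p, f p) == Some c)].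

(** [U] will be the principal filter of a point, or empty for the plain minimum. *)
Definition exchange (U : pred P) al be p : nat :=
  if U p then be p else minn (al p) (be p).

Definition up_closed (U : pred P) := forall p q, (p <= q)%O -> U p -> U q.

Lemma exchange_isotone U al be :
  up_closed U -> isotone al -> isotone be -> isotone (exchange U al be).
Proof.
move=> upU isoa isob p q pq; rewrite /exchange.
have := upU _ _ pq; have := isoa _ _ pq; have := isob _ _ pq.
by case: (U p); case: (U q) => // ? ? // H; try (by have := H isT); lia.
Qed.

Lemma exchange_le U al be p : (exchange U al be p <= be p)%N.
Proof. by rewrite /exchange; case: ifP => // _; lia. Qed.

Lemma exchange_or U al be p :
  exchange U al be p = al p \/ exchange U al be p = be p.
Proof. rewrite /exchange; case: ifP => // _; [by right | lia]. Qed.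

Hypothesis chain : forall c t t', kap t = Some c -> kap t' = Some c ->
  left_strict_comparable t t'.

(* Along a chain of P^op x N an isotone function is constant, so the points of
   a graph in one fiber all have the same height. *)
Lemma exchange_fiber U al be c :
  up_closed U -> isotone al -> isotone be ->
  (fiber_pts (exchange U al be) c \subset fiber_pts al c) \/
  (fiber_pts (exchange U al be) c \subset fiber_pts be c).
Proof.
move=> upU isoa isob; set g := exchange U al be.
have isog : isotone g := exchange_isotone upU isoa isob.
case: (boolP (_ \subset fiber_pts al c)) => [|/subsetPn[y]]; first by left.
rewrite !inE => /andP[yN /eqP ky] nya.
case: (boolP (_ \subset fiber_pts be c)) => [|/subsetPn[x]]; first by right.
rewrite !inE => /andP[xN /eqP kx] nxb; exfalso.
have gxb : g x <> be x by move=> E; move: nxb; rewrite -E xN kx eqxx.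
have gya : g y <> al y by move=> E; move: nya; rewrite -E yN ky eqxx.
have nUx : ~~ U x by apply/negP => Ux; apply: gxb; rewrite /g /exchange Ux.
have gx : g x = minn (al x) (be x) by rewrite /g /exchange (negPf nUx).
have gy : g y = be y by case: (exchange_or U al be y).
(* Either order forces [g x = g y]. If [y <= x], then [al y <= al x = g x = g y = be y < al y]; if
   [x <= y], then [be x <= be y = g y = g x < be x]. *)
have [+ _] := chain kx ky; rewrite /op_comparable /= => /orP[] /andP[le1 le2].
  have nUy : ~~ U y by apply: contra nUx; apply: upU.
  have : g y = minn (al y) (be y) by rewrite /g /exchange (negPf nUy).
  by have := isoa _ _ le1; have := isog _ _ le1; lia.
by have := isob _ _ le1; have := isog _ _ le1; lia.
Qed.

Section Pair.
Variables (a b : T).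
Hypothesis ab : a != b.
Hypothesis chain_ab : forall t t', kap t = Some a -> kap t' = Some b ->
  left_strict_comparable t t'.

(** Only the fibers over [a] and [b] can exceed [mu]. Over [a], the point [p] is lost; over [b],
    either [al] already gives the bound or some point of [be] is lost. *)
Lemma exchange_step (mu : T -> nat) al be p :
  isotone al -> isotone be ->
  (forall c, (#|fiber_pts al c| <= mu c + (c == a))%N) ->
  (forall c, (#|fiber_pts be c| <= mu c + (c == b))%N) ->
  p \in fiber_pts al a -> (al p < be p)%N ->
  forall c, (#|fiber_pts (exchange (fun x => p <= x)%O al be) c| <= mu c)%N.
Proof.
move=> isoa isob ca cb; rewrite inE => /andP[apN /eqP kp] abp c.
set U := (fun x => p <= x)%O; set g := exchange U al be.
have upU : up_closed U by move=> x y xy px; apply: le_trans xy.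
have gp : g p = be p by rewrite /g /exchange /U lexx.
(* [(p, al p)] and [(p, be p)] are distinct with the same first coordinate, so they cannot both lie
   over [a]. *)
have np : p \notin fiber_pts g a.
  rewrite inE; apply/negP => /andP[_ /eqP kgp].
  have [_] := chain kp kgp; rewrite gp; case/(_ _)/eqP => //.
  by apply/eqP => -[]; lia.
have [->{c}|] := eqVneq c a; last have [->{c}|ncb nca] := eqVneq c b.
- have [sub|sub] := exchange_fiber a upU isoa isob; last first.
    by have := subset_leq_card sub; have := cb a; rewrite (negPf ab) -/g; lia.
  have /proper_card : fiber_pts g a \proper fiber_pts al a.
    by apply/properP; split=> //; exists p => //; rewrite inE apN kp /=.
  by have := ca a; rewrite eqxx; lia.
- move=> _; have [sub|sub] := exchange_fiber b upU isoa isob.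
    by have := subset_leq_card sub; have := ca b; rewrite eq_sym (negPf ab) -/g; lia.
  have [sub'|/subsetPn[q qb qa]] := boolP (fiber_pts be b \subset fiber_pts al b).
    have := subset_leq_card sub; have := subset_leq_card sub'.
    by have := ca b; rewrite eq_sym (negPf ab) -/g; lia.
  have /proper_card : fiber_pts g b \proper fiber_pts be b.
    apply/properP; split=> //; exists q => //.
    apply/negP; rewrite inE => /andP[gqN /eqP kgq].
    have Eq : g q = be q.
      move: (subsetP sub q); rewrite inE gqN kgq eqxx => /(_ isT).
      rewrite inE => /andP[bqN /eqP kbq].
      apply/eqP/negP => /negP ne.
      have [_] := chain kgq kbq; case/(_ _)/eqP => //.
      by apply: contra ne => /eqP[->].
    move: qb qa; rewrite !inE => /andP[bqN /eqP kq].
    (* [p <= q] with [be q <= al p] contradicts [al p < be p <= be q]. Otherwise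
       [al q <= al p <= be q], and [g q = be q] forces [al q = be q], putting [q] in the fiber of
       [al]. *)
    have [+ neq] := chain_ab kp kq.
    rewrite /op_comparable /= => /orP[] /andP[le1 le2]; last first.
      have := isob _ _ le1; lia.
    have nUq : ~~ U q.
      rewrite /U; apply/negP => pq.
      have E : p = q by apply/le_anti; rewrite pq.
      have /= := neq; rewrite E eqxx => /(_ _)/negP[] //.
      by apply/eqP => -[]; move: abp; rewrite E; lia.
    have := isoa _ _ le1; move: Eq; rewrite /g /exchange (negPf nUq) => Eq apq.
    have -> : al q = be q by lia.
    by rewrite bqN kq eqxx.
  by have := cb b; rewrite eqxx; lia.
- have := ca c; have := cb c; rewrite (negPf nca) (negPf ncb).
  by have [/subset_leq_card|/subset_leq_card] := exchange_fiber c upU isoa isob; rewrite -/g; lia.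
Qed.

End Pair.

(** If the fiber of the minimum over [a] lies in that of [al], strictness and the assumed inequality
    make [al] and [be] agree there, so the bound for [be], which has no extra [1] at [a], applies.
    The fiber over [b] is symmetric. *)
Lemma exchange_min (mu : T -> nat) (a b : T) al be :
  a != b -> isotone al -> isotone be ->
  (forall c, (#|fiber_pts al c| <= mu c + (c == a))%N) ->
  (forall c, (#|fiber_pts be c| <= mu c + (c == b))%N) ->
  (forall p, p \in fiber_pts al a -> (be p <= al p)%N) ->
  (forall p, p \in fiber_pts be b -> (al p <= be p)%N) ->
  forall c, (#|fiber_pts (exchange pred0 al be) c| <= mu c)%N.
Proof.
move=> ab isoa isob ca cb ha hb c; set g := exchange _ _ _.
have sub_a p : p \in fiber_pts g a -> p \in fiber_pts al a -> p \in fiber_pts be a.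
  move=> pg pa; have := ha _ pa.
  move: pa pg; rewrite !inE => /andP[aN ka] /andP[gN kg] le.
  have [_] := chain (eqP ka) (eqP kg); have [E _|ne] := eqVneq (p, al p) (p, g p).
    have : be p = al p by move: E => -[]; rewrite /g /exchange /=; lia.
    by move=> ->; rewrite aN ka.
  by move=> /(_ isT) /eqP.
have sub_b p : p \in fiber_pts g b -> p \in fiber_pts be b -> p \in fiber_pts al b.
  move=> pg pb; have := hb _ pb.
  move: pb pg; rewrite !inE => /andP[bN kb] /andP[gN kg] le.
  have [_] := chain (eqP kb) (eqP kg); have [E _|ne] := eqVneq (p, be p) (p, g p).
    have : al p = be p by move: E => -[]; rewrite /g /exchange /=; lia.
    by move=> ->; rewrite bN kb.
  by move=> /(_ isT) /eqP.
have := ca c; have := cb c.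
have [/= sub|/= sub] : (fiber_pts g c \subset fiber_pts al c) \/ (fiber_pts g c \subset fiber_pts be c)
  by apply: exchange_fiber.
  have [E|_] := eqVneq c a; last first.
    by move=> _; rewrite addn0; apply: leq_trans (subset_leq_card sub).
  move: sub; rewrite {c}E (negPf ab) => /subsetP sub.
  have /subset_leq_card : fiber_pts g a \subset fiber_pts be a; last first.
    by move=> le1 le2 _; apply: leq_trans le1 _; rewrite addn0 in le2.
  by apply/subsetP => p pg; apply: sub_a => //; apply: sub.
have [E|_] := eqVneq c b; last first.
  by rewrite addn0 => cbc _; apply: leq_trans cbc; apply: subset_leq_card.
move: sub; rewrite {c}E eq_sym (negPf ab) => /subsetP sub.
have /subset_leq_card : fiber_pts g b \subset fiber_pts al b; last first.
  by move=> le1 _ le2; apply: leq_trans le1 _; rewrite addn0 in le2.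
by apply/subsetP => p pg; apply: sub_b => //; apply: sub.
Qed.

Lemma left_strict_comparableC t t' :
  left_strict_comparable t t' -> left_strict_comparable t' t.
Proof.
case=> cmp ne; split; last by rewrite eq_sym (eq_sym t'.1).
by move: cmp; rewrite /op_comparable orbC.
Qed.

Lemma exchange_exists (mu : T -> nat) (a b : T) al be :
  a != b ->
  (forall t t', kap t = Some a -> kap t' = Some b -> left_strict_comparable t t') ->
  isotone al -> isotone be ->
  (forall c, (#|fiber_pts al c| <= mu c + (c == a))%N) ->
  (forall c, (#|fiber_pts be c| <= mu c + (c == b))%N) ->
  exists g, [/\ isotone g,
    (forall p, (g p <= al p)%N) \/ (forall p, (g p <= be p)%N) &
    forall c, (#|fiber_pts g c| <= mu c)%N].
Proof.
move=> ab chab isoa isob ca cb.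
have [pa ha|na] := pickP [pred p | (p \in fiber_pts al a) && (al p < be p)%N].
  move: ha => /= /andP[ha hlt].
  exists (exchange (fun x => pa <= x)%O al be); split.
  - by apply: exchange_isotone => // x y xy px; apply: le_trans xy.
  - by right=> x; apply: exchange_le.
  - exact: (exchange_step ab chab).
have [pb hb|nb] := pickP [pred p | (p \in fiber_pts be b) && (be p < al p)%N].
  move: hb => /= /andP[hb hlt].
  exists (exchange (fun x => pb <= x)%O be al); split.
  - by apply: exchange_isotone => // x y xy px; apply: le_trans xy.
  - by left=> x; apply: exchange_le.
  - apply: (@exchange_step b a) => //; first by rewrite eq_sym.
    by move=> t t' kt kt'; apply/left_strict_comparableC/chab.
exists (exchange pred0 al be); split.
- exact: exchange_isotone.
- by right=> x; apply: exchange_le.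
- apply: (exchange_min ab) => // p hp.
    by move: (na p); rewrite /= hp /= ltnNge => /negbFE.
  by move: (nb p); rewrite /= hp /= ltnNge => /negbFE.
Qed.

End Exchange.

(** * Identification of variables along a list of pairs *)

(** [r] picks representatives for the equivalence relation generated by [l]. Quantifying over all
    equivalence relations [Q] lets the same [r] serve for fibers, ideals and spans. *)
Lemma contraction_exists n (l : seq ('I_n * 'I_n)) :
  exists r : 'I_n -> 'I_n,
    (forall b, b \in l -> r b.1 = r b.2) /\
    forall Q : 'I_n -> 'I_n -> Prop,
      (forall v, Q v v) -> (forall v w, Q v w -> Q w v) ->
      (forall u v w, Q u v -> Q v w -> Q u w) ->
      (forall b, b \in l -> Q b.1 b.2) -> forall v, Q v (r v).
Proof.
elim: l => [|b l [r [rl rQ]]]; first by exists id; split.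
(* The class represented by [r b.1] is merged into that of [r b.2]. *)
exists (fun v => if r v == r b.1 then r b.2 else r v); split.
  move=> b'; rewrite inE => /orP[/eqP->|/rl -> //].
  by rewrite eqxx; case: ifP.
move=> Q Qr Qs Qt Ql v.
have {}rQ w : Q w (r w).
  by apply: rQ => // b' b'l; apply: Ql; rewrite inE b'l orbT.
case: ifP => [/eqP E|_]; last exact: rQ.
apply: (Qt _ _ _ (rQ v)); rewrite E; apply: (Qt _ _ _ (Qs _ _ (rQ b.1))).
by apply: (Qt _ _ _ _ (rQ b.2)); apply: Ql; rewrite inE eqxx.
Qed.

Section Contraction.
Variables (k : fieldType) (n : nat) (r : 'I_n -> 'I_n).

Definition contract (f : {mpoly k[n]}) : {mpoly k[n]} :=
  f \mPo [tuple 'X_(r i) | i < n].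

Lemma contractX i : contract 'X_i = 'X_(r i).
Proof. by rewrite /contract comp_mpolyXU -tnth_nth tnth_mktuple. Qed.

Lemma contractB f g : contract (f - g) = contract f - contract g.
Proof. exact: comp_mpolyB. Qed.

Lemma contractD f g : contract (f + g) = contract f + contract g.
Proof. exact: comp_mpolyD. Qed.

Lemma contractM f g : contract (f * g) = contract f * contract g.
Proof. exact: rmorphM. Qed.

Lemma contract_prod (T : Type) (s : seq T) (Q : pred T) F :
  contract (\prod_(x <- s | Q x) F x) = \prod_(x <- s | Q x) contract (F x).
Proof. exact: rmorph_prod. Qed.

(** The polynomials congruent to their contraction include constants and variables and are closed
    under sums and products. *)
Lemma sub_contract_in_ideal (G : {mpoly k[n]} -> Prop) f :
  (forall i, in_ideal G ('X_i - 'X_(r i))) -> in_ideal G (f - contract f).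
Proof.
move=> GX; pose Q h := in_ideal G (h - contract h).
have Q1 : Q 1 by rewrite /Q /contract comp_mpoly1 subrr; apply: in_ideal0.
have QM g h : Q g -> Q h -> Q (g * h).
  move=> Qg Qh; rewrite /Q contractM.
  have -> : g * h - contract g * contract h =
    h * (g - contract g) + contract g * (h - contract h).
    by rewrite !mulrBr [h * g]mulrC [h * _]mulrC addrA subrK.
  by apply: in_idealD; apply: in_idealMl.
rewrite -/(Q f) [f]mpolyE; apply: (big_ind Q) => [|g h Qg Qh|m _].
- by rewrite /Q /contract comp_mpoly0 subrr; apply: in_ideal0.
- by rewrite /Q contractD opprD addrACA; apply: in_idealD.
rewrite -mul_mpolyC; apply: (QM _ _).
  by rewrite /Q /contract comp_mpolyC subrr; apply: in_ideal0.
rewrite mpolyXE_id; apply: (big_ind Q) => [//|g h|i _]; first exact: QM.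
elim: (m i) => [|e IH]; first by rewrite expr0.
by rewrite exprS; apply: QM => //; rewrite /Q contractX; apply: GX.
Qed.

End Contraction.

(** * The contracted co-letterplace ideal and its saturation *)

Section ContractedIdeal.
Variables (k : fieldType) (d : Order.disp_t) (P : finPOrderType d).
Variables (J : (P -> nat) -> Prop) (n : nat) (S : n.-tuple (P * nat)).
Variable r : 'I_n -> 'I_n.

Definition var_idx (t : P * nat) : option 'I_n := insub (index t S).

Definition contracted_idx (t : P * nat) : option 'I_n := omap r (var_idx t).

Lemma var_idxP t v : var_idx t = Some v -> t \in S /\ tnth S v = t.
Proof.
rewrite /var_idx; case: insubP => // w; rewrite -{2}(size_tuple S) index_mem.
by move=> tS wE [<-]; split=> //; rewrite (tnth_nth t) wE nth_index.
Qed.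

Lemma xvarE t v : var_idx t = Some v -> xvar S k t = 'X_v.
Proof. by rewrite /var_idx /xvar => ->. Qed.

Lemma contracted_idxP t c :
  contracted_idx t = Some c ->
  exists v, [/\ var_idx t = Some v, t \in S, tnth S v = t & r v = c].
Proof.
rewrite /contracted_idx; case E: var_idx => [v|] //= [<-].
by have [tS vt] := var_idxP E; exists v.
Qed.

(** Exponents are counts because contraction can merge several points of a graph into one
    variable. *)
Definition graph_mnm (I : {set P}) (a : P -> nat) : 'X_{1..n} :=
  [multinom #|[set p in I | contracted_idx (p, a p) == Some c]| | c < n].

Hypothesis Supp_S : forall t, Supp J t -> t \in S.

Lemma contract_mono I a :
  min_marker J I a -> contract r (mono S k I a) = 'X_[graph_mnm I a].
Proof.
move=> minI.
pose F p := if contracted_idx (p, a p) is Some c then U_(c)%MM else 0%MM.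
have XF p : p \in I -> contract r (xvar S k (p, a p)) = 'X_[F p].
  (* Graph points of a minimal marker lie in [S], so no factor is the default [0] of [xvar]. *)
  move=> pI; have pS : (p, a p) \in S by apply: Supp_S; exists I, a.
  have [v Ev] : exists v, var_idx (p, a p) = Some v.
    rewrite /var_idx; case: insubP => [v _ _|]; first by exists v.
    by rewrite -{2}(size_tuple S) index_mem pS.
  by rewrite (xvarE Ev) contractX /F /contracted_idx Ev.
rewrite /mono contract_prod (eq_bigr _ XF).
rewrite -(big_morph (fun m => 'X_[m]) (@mpolyXD n k) (@mpolyX0 n k)).
congr 'X_[_]; apply/mnmP => c; rewrite mnm_sumE mnmE -sum1_card.
rewrite [RHS](eq_bigl (fun p => (p \in I) && (contracted_idx (p, a p) == Some c))).
  rewrite [RHS]big_mkcondr; apply: eq_bigr => p _; rewrite /F.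
  by case: contracted_idx => [c'|]; rewrite ?mnm0E // mnm1E; case: eqVneq => [->|/eqP ne];
    case: eqP => // -[].
by move=> p; rewrite inE.
Qed.

Lemma graph_mnm_capped N (I : {set P}) a c :
  (forall p, (a p < N)%N) ->
  graph_mnm I a c = #|fiber_pts contracted_idx N (capped N I a) c|.
Proof.
move=> aN; rewrite mnmE; apply: eq_card => p; rewrite !inE /capped.
by case: ifP; rewrite ?aN ?ltnn.
Qed.

Definition contracted_gen (u : 'X_{1..n}) : Prop :=
  exists I a, min_marker J I a /\ u = graph_mnm I a.

Hypothesis idealJ : hom_ideal J.
Variables (d' : Order.disp_t) (R : porderType d') (phi : P * nat -> R).
Hypothesis strict : left_strict_chain_fibers S phi.
Hypothesis phi_r : forall v, phi (tnth S v) = phi (tnth S (r v)).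

(** As [r] preserves fibers of [phi], both points lie in one fiber. This serves for [c = c'] and for
    the pair [a], [b]. *)
Lemma contracted_comparable c c' t t' :
  phi (tnth S c) = phi (tnth S c') ->
  contracted_idx t = Some c -> contracted_idx t' = Some c' ->
  left_strict_comparable t t'.
Proof.
move=> Ecc' /contracted_idxP[v [_ tS vt rv]] /contracted_idxP[v' [_ t'S vt' rv']].
have : phi t = phi t' by rewrite -vt -vt' phi_r rv Ecc' -rv' -phi_r.
by case/(strict tS t'S).
Qed.

Lemma contracted_saturated (a b : 'I_n) m :
  a != b -> phi (tnth S a) = phi (tnth S b) ->
  (exists2 u, contracted_gen u & (u <= m + U_(a))%MM) ->
  (exists2 u, contracted_gen u & (u <= m + U_(b))%MM) ->
  (exists2 u, contracted_gen u & (u <= m)%MM).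
Proof.
move=> ab phiab [_ [I1 [a1 [[m1 _] ->]]] le1] [_ [I2 [a2 [[m2 _] ->]]] le2].
(* The cap exceeds all values of both maps, including the irrelevant ones off their domains. *)
pose N := (\sum_p (a1 p + a2 p)).+1%N.
have aN p : (a1 p < N)%N /\ (a2 p < N)%N.
  by rewrite /N (bigD1 p) //=; lia.
have aN1 p := (aN p).1; have aN2 p := (aN p).2.
have [||||||g [isog leg cg]] := @exchange_exists _ P _ contracted_idx N
    _ (fun c => m c) a b (capped N I1 a1) (capped N I2 a2) ab.
- by move=> c t t'; apply: contracted_comparable.
- by move=> t t'; apply: contracted_comparable.
- exact: capped_isotone m1 aN1.
- exact: capped_isotone m2 aN2.
- move=> c; rewrite -graph_mnm_capped //.
  by have /mnm_lepP/(_ c) := le1; rewrite mnmDE mnm1E eq_sym.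
- move=> c; rewrite -graph_mnm_capped //.
  by have /mnm_lepP/(_ c) := le2; rewrite mnmDE mnm1E eq_sym.
have mg : is_marker J (capped_dom N g) g.
  case: leg => leg.
    apply: (marker_le idealJ (capped_isotone m1 aN1) isog leg).
    exact: capped_marker.
  apply: (marker_le idealJ (capped_isotone m2 aN2) isog leg).
  exact: capped_marker.
(* [g] need not be minimal; a minimal marker inside it only lowers the counts. *)
have [I [a' [minI sI ea']]] := min_marker_below mg.
exists (graph_mnm I a'); first by exists I, a'.
apply/mnm_lepP => c; rewrite mnmE; apply: leq_trans (cg c).
apply: subset_leq_card; apply/subsetP => p; rewrite !inE => /andP[pI].
by rewrite ea' // => ->; move: (subsetP sI p pI); rewrite inE => ->.
Qed.

End ContractedIdeal.

(** * Regularity of the sequence of differences *)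

Theorem theorem2p2 (k : fieldType) (d : Order.disp_t) (P : finPOrderType d)
  (J : (P -> nat) -> Prop) (n : nat) (S : n.-tuple (P * nat))
  (d' : Order.disp_t) (R : porderType d') (phi : P * nat -> R)
  (B : seq ('I_n * 'I_n)) :
  hom_ideal J ->
  uniq S ->
  (forall t, Supp J t -> t \in S) ->
  isotone_S S phi ->
  left_strict_chain_fibers S phi ->
  (forall b, b \in B -> phi (tnth S b.1) = phi (tnth S b.2)) ->
  kernel_basis k S phi B ->
  regular_seq (@L_gens _ P n S k J) [seq 'X_b.1 - 'X_b.2 | b <- B].
Proof.
move=> idealJ _ Supp_S _ strict phiB [freeB _] i; rewrite size_map => iB g.
have [x0 _] : exists x0 : 'I_n * 'I_n, True by case: (B) iB => // x0; exists x0.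
rewrite (nth_map x0) // -map_take.
set l := take i B; set b := nth x0 B i.
pose G h := L_gens S J h \/ h \in [seq 'X_b0.1 - 'X_b0.2 : {mpoly k[n]} | b0 <- l].
rewrite -/G => Gbg.
have [r [rl rQ]] := contraction_exists l.
have lB b' : b' \in l -> b' \in B by apply: mem_take.
have phi_r v : phi (tnth S v) = phi (tnth S (r v)).
  apply: (rQ (fun v w => phi (tnth S v) = phi (tnth S w))) => //.
    by move=> ? ? ? -> ->.
  by move=> b' /lB; apply: phiB.
have GX v : in_ideal G ('X_v - 'X_(r v)).
  apply: (rQ (fun v w => in_ideal G ('X_v - 'X_w))) => [w|v' w|u v' w|b' b'l].
  - by rewrite subrr; apply: in_ideal0.
  - by rewrite -(opprB 'X_v'); apply: in_idealN.
  - by move=> /in_idealD /[apply]; rewrite addrA subrK.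
  - by apply: in_ideal_gen; right; apply: map_f.
(* If the next pair were already identified, its difference vector would lie in the span of the
   earlier ones, against freeness. *)
have rab : r b.1 != r b.2.
  apply/eqP => Er.
  pose V := <<[seq diffvec k b' | b' <- l]>>%VS.
  have dv v : delta_mx 0 v - delta_mx 0 (r v) \in V.
    apply: (rQ (fun v w => delta_mx 0 v - delta_mx 0 w \in V)) => [w|v' w|u v' w|b' b'l].
    - by rewrite subrr mem0v.
    - by rewrite -(opprB (delta_mx 0 v')) memvN.
    - by move=> /memvD /[apply]; rewrite addrA subrK.
    - exact/memv_span/map_f.
  have bV : diffvec k b \in V.
    by have := memvB (dv b.1) (dv b.2); rewrite Er opprB addrA subrK.
  move: freeB; rewrite -(cat_take_drop i B) (drop_nth x0 iB) map_cat /=.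
  rewrite -/l -/b (perm_free (permEl (perm_catCA _ [:: _] _))) /= free_cons => /andP[/negP[]].
  by move: bV; apply/subvP; rewrite span_cat addvSl.
have sub_G f : in_ideal G (f - contract r f) by exact: sub_contract_in_ideal.
pose M (h : {mpoly k[n]}) := exists2 u, contracted_gen J S r u & h = 'X_[u].
(* With [fromM], this makes membership in [G] equivalent to membership of the contraction in the
   monomial ideal [M]: contraction kills the earlier differences and changes [f] only modulo [G]. *)
have toM f : in_ideal G f -> in_ideal M (contract r f).
  apply: (in_ideal_ind (Q := fun f => in_ideal M (contract r f))).
  - by rewrite /contract comp_mpoly0; apply: in_ideal0.
  - by move=> f1 f2; rewrite contractD; apply: in_idealD.
  move=> c h Gh; rewrite contractM; apply: in_idealMl.
  case: Gh => [[I [a [minI ->]]]|/mapP[b' b'l ->]].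
    apply: in_ideal_gen; rewrite (contract_mono _ _ Supp_S minI).
    by exists (graph_mnm S r I a) => //; exists I, a.
  by rewrite contractB !contractX rl // subrr; apply: in_ideal0.
have fromM f : in_ideal M (contract r f) -> in_ideal G f.
  move=> Mf; rewrite -(subrK (contract r f) f); apply: in_idealD => //.
  apply: in_ideal_sub Mf => h [_ [I [a [minI ->]]] ->].
  rewrite -(contract_mono k r Supp_S minI).
  rewrite -[contract r _](subKr (mono S k I a)); apply: in_idealB => //.
  by apply: in_ideal_gen; left; exists I, a.
apply: fromM; have := toM _ Gbg; rewrite contractM contractB !contractX.
move=> /mem_monomial_ideal Mb; apply/mem_monomial_ideal.
apply: (monomial_nzd _ rab _ Mb) => [m u [w Gw wm]|m].
  by exists w => //; apply: lepm_trans wm _; rewrite lem_addr.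
apply: (contracted_saturated idealJ strict phi_r rab).
by rewrite -!phi_r; apply/phiB/mem_nth.
Qed.
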